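(* The density function $h_x(b)\equiv f_b(x)$, $0\le b\le 1$, for the limiting rescaled card number occupying a position around $xn$, has the following behavior. For $x=0$, one has $h_0(b)=e^{b-1}$, $0<b\le1$. This is a sub-probability density with total mass $1-e^{-1}$. In addition there is a $\delta$-mass of size $e^{-1}$ at $b=0$. For $x=1$, one has $h_1(b)=\dfrac{e^b}{e-1}$, $0\le b\le1$. Let $b_x$, $0\le x<1$, denote the inverse of the function $x_b=e^{1-b}-(1-b)e$. For $0<x<1$, one has (i) $h_x(0)=\dfrac{e^{b_x-1}}{e^{b_x}-1}$; (ii) $h_x(b)$ is increasing and convex on $0<b<b_x$; (iii) $h_x(b_x^-)=\dfrac{e^{b_x-1}}{1-e^{-b_x}}$ (left-hand limit at $b_x$); (iv) $h_x(b)=e^{b-1}$, $b_x<b\le1$.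
   Context: For $b\in[0,1]$ define $G_b:[0,1]\to[0,1]$ by $G_b(y)=ye^{1-b}$ for $0\le y\le 1-(1-b)e^b$ and $G_b(y)=e^{(1-y)e^{-b}}-(1-y)e^{1-b}$ for $1-(1-b)e^b\le y\le1$. Let $F_b=G_b^{-1}$, a distribution function on $[0,1]$, and let $f_b$ be its density. Probabilistic meaning: $f_b$ is the density of the limiting distribution of $\frac1n$ times the final position of a card with number asymptotic to $bn$ after one card-cyclic to random insertion shuffle of $n$ cards started in increasing order (the cards $1,2,\dots,n$ are, in this order, each removed once and reinserted in a uniformly random one of the $n$ positions). The function $h_x$ is interpreted as the density of the limiting rescaled number of the card occupying a position around $xn$; the existence of that limit is not proved, and the mathematical definition of $h_x$ is $h_x(b)\equiv f_b(x)$. *)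

(* Defs.v *)
From Stdlib Require Import Reals Lra Psatz ClassicalEpsilon.
From Coquelicot Require Import Coquelicot.
Open Scope R_scope.

Definition brk (b : R) : R := 1 - (1 - b) * exp b.

(* The two formulas of G_b are kept for every real y. For 0 <= b <= 1 the
   resulting G_b is increasing on the line and restricts to a bijection of
   [0,1] onto itself (lemma F_inverse below). *)
Definition G (b y : R) : R :=
  if Rle_dec y (brk b) then y * exp (1 - b)
  else exp ((1 - y) * exp (- b)) - (1 - y) * exp (1 - b).

Definition F (b x : R) : R := epsilon (inhabits 0) (fun y => G b y = x).

(* A density is only determined up to null sets: the version used is the
   right-hand derivative of F_b. It is the ordinary derivative of F_b at every
   point of (0,1) other than the break point G_b(brk b), and there it is the
   value coming from the second formula. At x = 1 it uses the second formula
   beyond y = 1: for b < 1 this is the left-hand derivative of F_b at 1, and for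
   b = 1, where the break point is 1 itself, it is again the value coming from
   the second formula. It is infinite, hence not specified, only for
   b = x = 0. *)
Definition f (b x : R) : R :=
  epsilon (inhabits 0)
    (fun l => filterlim (fun t => (F b (x + t) - F b x) / t)
                (at_right 0) (locally l)).

Definition h (x b : R) : R := f b x.

Definition xb (b : R) : R := exp (1 - b) - (1 - b) * exp 1.

(* [xb] is injective on [0,1] but not on the whole line. *)
Definition bx (x : R) : R :=
  epsilon (inhabits 0) (fun b => 0 <= b <= 1 /\ xb b = x).

Definition increasing_on (g : R -> R) (lo hi : R) : Prop :=
  forall s t, lo < s -> s < t -> t < hi -> g s < g t.

Definition convex_on (g : R -> R) (lo hi : R) : Prop :=
  forall s t c, lo < s < hi -> lo < t < hi -> 0 <= c <= 1 ->
    g (c * s + (1 - c) * t) <= c * g s + (1 - c) * g t.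

Definition sub_probability_density (g : R -> R) (mass : R) : Prop :=
  (forall b, 0 < b <= 1 -> 0 <= g b) /\ is_RInt g 0 1 mass /\ mass <= 1.

(* As x decreases to 0, the measures g_x(b) db on [0,1] converge weakly to
   g_0(b) db + c delta_0. *)
Definition weakly_converges_with_atom_at_0
    (g : R -> R -> R) (g0 : R -> R) (c : R) : Prop :=
  forall phi : R -> R, (forall b, continuous phi b) ->
    (forall x, 0 < x < 1 -> ex_RInt (fun b => phi b * g x b) 0 1) /\
    ex_RInt (fun b => phi b * g0 b) 0 1 /\
    filterlim (fun x => RInt (fun b => phi b * g x b) 0 1) (at_right 0)
      (locally (RInt (fun b => phi b * g0 b) 0 1 + c * phi 0)).

Lemma brk_range b : 0 <= b <= 1 -> 0 <= brk b <= 1.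
Proof.
intros Hb; unfold brk; pose proof (exp_pos b) as Pb.
split; [|nra].
assert (H : 1 - b <= exp (- b)).
{ destruct (Req_dec b 0) as [->|Hn]; [rewrite Ropp_0, exp_0; lra|].
  pose proof (exp_ineq1 (- b) ltac:(lra)); lra. }
assert (E : exp (- b) * exp b = 1) by (rewrite <- exp_plus, Rplus_opp_l; apply exp_0).
nra.
Qed.

Lemma second_formula b y : (1 - y) * exp (1 - b) = (1 - y) * exp (- b) * exp 1.
Proof. rewrite Rmult_assoc, <- exp_plus; do 2 f_equal; ring. Qed.

Lemma brk_u b : (1 - brk b) * exp (- b) = 1 - b.
Proof.
unfold brk; replace (1 - (1 - (1 - b) * exp b)) with ((1 - b) * exp b) by ring.
rewrite Rmult_assoc, <- exp_plus, Rplus_opp_r, exp_0; ring.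
Qed.

Lemma G_second b y : brk b <= y ->
  G b y = exp ((1 - y) * exp (- b)) - (1 - y) * exp (1 - b).
Proof.
intros H; unfold G; destruct (Rle_dec y (brk b)) as [H'|]; [|easy].
assert (E : y = brk b) by lra; rewrite E, second_formula, brk_u.
replace (brk b) with (1 - (1 - b) * exp b) by easy.
replace ((1 - (1 - b) * exp b) * exp (1 - b))
  with (exp (1 - b) - (1 - b) * (exp b * exp (1 - b))) by ring.
rewrite <- exp_plus; replace (b + (1 - b)) with 1 by ring; ring.
Qed.

Lemma G_increasing b y z : 0 <= b -> y < z -> G b y < G b z.
Proof.
intros Hb.
assert (H1 : forall y z, y < z -> z <= brk b -> G b y < G b z).
{ intros y' z' Hyz Hz; unfold G.
  destruct (Rle_dec y' (brk b)); [|lra]; destruct (Rle_dec z' (brk b)); [|lra].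
  pose proof (exp_pos (1 - b)); nra. }
assert (H2 : forall y z, y < z -> brk b <= y -> G b y < G b z).
{ intros y' z' Hyz Hy; rewrite !G_second by lra; rewrite !second_formula.
  pose proof (exp_pos (- b)) as Pb; pose proof (brk_u b) as Eu.
  set (v := (1 - y') * exp (- b)); set (u := (1 - z') * exp (- b)).
  assert (Huv : u < v) by (unfold u, v; nra).
  assert (Hv : v <= 1) by (unfold v; nra).
  assert (Ev : exp v <= exp 1).
  { destruct (Req_dec v 1) as [->|]; [lra|].
    apply Rlt_le, exp_increasing; lra. }
  pose proof (exp_ineq1 (u - v) ltac:(lra)) as I.
  assert (E : exp u = exp v * exp (u - v)) by (rewrite <- exp_plus; f_equal; ring).
  pose proof (exp_pos v); nra. }
intros Hyz; destruct (Rle_dec z (brk b)); [auto|].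
destruct (Rle_dec (brk b) y); [auto|].
apply Rlt_trans with (G b (brk b)); [apply H1|apply H2]; lra.
Qed.

Lemma G_0 b : 0 <= b <= 1 -> G b 0 = 0.
Proof.
intros Hb; pose proof (brk_range b Hb); unfold G.
destruct (Rle_dec 0 (brk b)); [ring|lra].
Qed.

Lemma G_1 b : 0 <= b <= 1 -> G b 1 = 1.
Proof.
intros Hb; pose proof (brk_range b Hb); rewrite G_second by lra.
replace (1 - 1) with 0 by ring; rewrite !Rmult_0_l, exp_0; ring.
Qed.

Lemma F_inverse b : 0 <= b <= 1 ->
  (forall y, 0 <= y <= 1 -> 0 <= G b y <= 1 /\ F b (G b y) = y) /\
  (forall x, 0 <= x <= 1 -> 0 <= F b x <= 1 /\ G b (F b x) = x).
Proof.
intros Hb; pose proof (brk_range b Hb) as Hr.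
assert (FG : forall y, F b (G b y) = y).
{ intros y; unfold F.
  pose proof (epsilon_spec (inhabits 0) (fun z => G b z = G b y)
    (ex_intro _ y eq_refl)) as E; cbv beta in E.
  destruct (Rtotal_order (epsilon (inhabits 0) (fun z => G b z = G b y)) y)
    as [L|[L|L]]; trivial; apply (G_increasing b) in L; lra. }
split.
- intros y Hy; split; [|apply FG].
  split.
  + rewrite <- (G_0 b Hb); destruct (Req_dec y 0) as [->|]; [lra|].
    apply Rlt_le, G_increasing; lra.
  + rewrite <- (G_1 b Hb); destruct (Req_dec y 1) as [->|]; [lra|].
    apply Rlt_le, G_increasing; lra.
- intros x Hx.
  enough (exists y, 0 <= y <= 1 /\ G b y = x) as (y & Hy & <-)
    by (rewrite FG; easy).
  destruct (Rle_dec x (G b (brk b))) as [L|L].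
  + exists (x * exp (b - 1)).
    assert (E : exp (b - 1) * exp (1 - b) = 1)
      by (rewrite <- exp_plus; replace (b - 1 + (1 - b)) with 0 by ring; apply exp_0).
    pose proof (exp_pos (b - 1)); pose proof (exp_pos (1 - b)).
    assert (B : x * exp (b - 1) <= brk b).
    { unfold G in L; destruct (Rle_dec (brk b) (brk b)); [|lra].
      replace (brk b) with (brk b * exp (1 - b) * exp (b - 1))
        by (rewrite Rmult_assoc, (Rmult_comm (exp (1 - b))), E; ring).
      apply Rmult_le_compat_r; lra. }
    split; [split; [nra|lra]|].
    unfold G; destruct (Rle_dec (x * exp (b - 1)) (brk b)); [|lra].
    rewrite Rmult_assoc, E; ring.
  + pose (g := fun y => exp ((1 - y) * exp (- b)) - (1 - y) * exp (1 - b)).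
    assert (E1 : g 1 = 1) by (unfold g; rewrite <- G_second by lra; auto using G_1).
    assert (E2 : g (brk b) = G b (brk b)) by (unfold g; rewrite G_second; lra).
    assert (C : continuity g).
    { intros y; apply derivable_continuous_pt; unfold g; reg. }
    destruct (IVT_gen g (brk b) 1 x C) as (y & Hy & Ey).
    { rewrite E1, E2, Rmin_left, Rmax_right; lra. }
    rewrite Rmin_left, Rmax_right in Hy by lra.
    exists y; split; [lra|]; rewrite G_second by lra; exact Ey.
Qed.

(* Main.v *)
(** The break point of [G_b] is sent to [x_b = G_b (brk b)], and [x_b] increases
    with [b].  In terms of [u = (1 - y) e^(-b)] the second formula of [G_b] reads
    [e^u - e u], which no longer involves [b], and [x_beta] is its value at
    [u = 1 - beta].  So for [x = x_beta] and [b <= beta] one has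
    [F_b (x) = 1 - (1 - beta) e^b], and inverting the derivative of [G_b] there
    gives [h_x (b) = e^(b-1) / (1 - e^(-beta))]; for [b > beta] the first formula
    gives [h_x (b) = e^(b-1)].  The excess of [h_x] over [e^(b-1)] is
    [e^(b-1) / (e^beta - 1)] on [[0, beta]], and this tends to [e^(-1)] times the
    Dirac mass at [0] as [beta] tends to [0]. *)
Require Import Defs.
From Stdlib Require Import Reals Lra Psatz ClassicalEpsilon.
From Coquelicot Require Import Coquelicot.
Open Scope R_scope.

(** * Sign bounds for the exponential, and right-hand slopes of inverse functions *)

Lemma exp_minus_1_pos z : 0 < z -> 0 < exp z - 1.
Proof. intros Hz; pose proof (exp_ineq1 z ltac:(lra)); lra. Qed.

Lemma one_minus_exp_opp_pos z : 0 < z -> 0 < 1 - exp (- z).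
Proof.
intros Hz; pose proof (exp_increasing (- z) 0 ltac:(lra)) as H.
rewrite exp_0 in H; lra.
Qed.

Lemma is_derive_right_slope (g : R -> R) (y d : R) : is_derive g y d ->
  filterlim (fun s => (g s - g y) / (s - y)) (at_right y) (locally d).
Proof.
intros D; apply is_derive_Reals in D.
apply filterlim_locally; intros e.
destruct (D e (cond_pos e)) as [r Hr].
exists r; intros s Bs Hs.
change (Rabs (s - y) < r) in Bs.
change (Rabs ((g s - g y) / (s - y) - d) < e).
specialize (Hr (s - y) ltac:(lra) Bs).
rewrite Rplus_minus in Hr; exact Hr.
Qed.

(** A one-sided inverse function rule: substituting [s = k (x + t)] turns the quotient of [k] into
    the reciprocal of that of [g]. Only right-hand slopes enter, since [G b] may have a kink at the
    point in question. *)
Lemma right_slope_inverse (g k : R -> R) (x d : R) :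
  (forall s t, s < t -> g s < g t) ->
  (forall t, x <= t -> g (k t) = t) ->
  filterlim (fun s => (g s - x) / (s - k x)) (at_right (k x)) (locally d) ->
  d <> 0 ->
  filterlim (fun t => (k (x + t) - k x) / t) (at_right 0) (locally (/ d)).
Proof.
intros Inc Inv Sl Hd.
assert (Anti : forall s t, g s < g t -> s < t).
{ intros s t H; destruct (Rtotal_order s t) as [L|[->|L]]; trivial; [lra|].
  apply Inc in L; lra. }
assert (Hx : g (k x) = x) by (apply Inv; lra).
assert (Up : forall t, 0 < t -> k x < k (x + t)).
{ intros t Ht; apply Anti; rewrite !Inv; lra. }
assert (Ck : filterlim (fun t => k (x + t)) (at_right 0) (at_right (k x))).
{ intros P [e He].
  (* The rise of [g] over a step [e] is the radius in [t] that keeps [k (x + t)] within [e] of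
     [k x]. *)
  assert (Hp : 0 < g (k x + e) - x).
  { pose proof (cond_pos e); pose proof (Inc (k x) (k x + e) ltac:(lra)); lra. }
  exists (mkposreal _ Hp); intros t Bt Ht.
  change (Rabs (t - 0) < g (k x + e) - x) in Bt.
  rewrite Rabs_right in Bt by lra.
  pose proof (Up t Ht) as Hu; apply He; [|easy].
  change (Rabs (k (x + t) - k x) < e); rewrite Rabs_right by lra.
  assert (k (x + t) < k x + e); [|lra].
  apply Anti; rewrite Inv; lra. }
pose proof (filterlim_comp _ _ _ _ _ _ _ _ Ck Sl) as H1.
pose proof (filterlim_Rbar_inv (Finite d)) as H2.
assert (H3 : filterlim Rinv (locally d) (locally (/ d)))
  by (apply H2; intros E; injection E; auto).
pose proof (filterlim_comp _ _ _ _ _ _ _ _ H1 H3) as H4.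
refine (filterlim_ext_loc _ _ _ H4).
exists (mkposreal 1 Rlt_0_1); intros t _ Ht.
rewrite Inv by lra; pose proof (Up t Ht); field; lra.
Qed.

(** * The [epsilon] choices in [f] and [F], and inversion of [G] past 1 *)

Lemma f_unique (b x l : R) :
  filterlim (fun t => (F b (x + t) - F b x) / t) (at_right 0) (locally l) ->
  Defs.f b x = l.
Proof.
intros H; unfold Defs.f.
pose proof (epsilon_spec (inhabits 0)
  (fun l => filterlim (fun t => (F b (x + t) - F b x) / t) (at_right 0) (locally l))
  (ex_intro _ l H)) as E; cbv beta in E.
exact (filterlim_locally_unique _ _ _ E H).
Qed.

Lemma F_G b y : 0 <= b -> F b (G b y) = y.
Proof.
intros Hb; unfold F.
pose proof (epsilon_spec (inhabits 0) (fun z => G b z = G b y)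
  (ex_intro _ y eq_refl)) as E; cbv beta in E.
destruct (Rtotal_order (epsilon (inhabits 0) (fun z => G b z = G b y)) y)
  as [L|[L|L]]; trivial; apply (G_increasing b) in L; lra.
Qed.

(** The right-hand quotient of [F b] at 1 evaluates [F b] beyond 1, outside the range of
    [F_inverse]. There the second formula is continuous and unbounded above. *)
Lemma G_F b x : 0 <= b <= 1 -> 0 <= x -> G b (F b x) = x.
Proof.
intros Hb Hx; destruct (Rle_dec x 1) as [L|L].
{ apply F_inverse; lra. }
pose proof (brk_range b Hb) as Hr.
pose (g := fun y => exp ((1 - y) * exp (- b)) - (1 - y) * exp (1 - b)).
assert (E1 : g 1 = 1) by (unfold g; rewrite <- G_second by lra; auto using G_1).
(* At [1 + x] the linear term alone equals [x * exp (1 - b)], and [exp (1 - b)] is at least 1. *)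
assert (E2 : x <= g (1 + x)).
{ unfold g; pose proof (exp_pos ((1 - (1 + x)) * exp (- b))).
  pose proof (exp_ineq1_le (1 - b)); nra. }
assert (C : continuity g)
  by (intros y; apply derivable_continuous_pt; unfold g; reg).
destruct (IVT_gen g 1 (1 + x) x C) as (y & Hy & Ey).
{ rewrite E1, Rmin_left, Rmax_right; lra. }
rewrite Rmin_left, Rmax_right in Hy by lra.
replace x with (G b y); [now rewrite F_G by lra|].
rewrite G_second by lra; exact Ey.
Qed.

(** * The break value [xb] and its inverse [bx] on the unit interval *)

Lemma xb_G b : xb b = G b (brk b).
Proof.
unfold G; destruct (Rle_dec (brk b) (brk b)); [|lra].
unfold brk, xb.
replace (exp 1) with (exp b * exp (1 - b))
  by (rewrite <- exp_plus; f_equal; ring).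
ring.
Qed.

Lemma xb_0 : xb 0 = 0.
Proof. unfold xb; rewrite Rminus_0_r; ring. Qed.

Lemma xb_1 : xb 1 = 1.
Proof. unfold xb; rewrite Rminus_diag, exp_0; ring. Qed.

(** The strict tangent inequality for [exp] at [1 - b] bounds the increment strictly below by
    [(c - b) * (exp 1 - exp (1 - b))], which is nonnegative. *)
Lemma xb_increasing b c : 0 <= b -> b < c -> xb b < xb c.
Proof.
intros Hb Hbc; unfold xb.
pose proof (exp_ineq1 (b - c) ltac:(lra)) as I.
assert (E : exp (1 - c) = exp (1 - b) * exp (b - c))
  by (rewrite <- exp_plus; f_equal; ring).
assert (L : exp (1 - b) <= exp 1).
{ destruct (Req_dec b 0) as [->|]; [rewrite Rminus_0_r; lra|].
  apply Rlt_le, exp_increasing; lra. }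
pose proof (exp_pos (1 - b)); rewrite E; nra.
Qed.

Lemma bx_spec x : 0 <= x <= 1 -> 0 <= bx x <= 1 /\ xb (bx x) = x.
Proof.
intros Hx; unfold bx.
apply (epsilon_spec (inhabits 0) (fun b => 0 <= b <= 1 /\ xb b = x)).
assert (C : continuity xb)
  by (intros y; apply derivable_continuous_pt; unfold xb; reg).
destruct (IVT_gen xb 0 1 x C) as (b & Hb & Eb).
{ rewrite xb_0, xb_1, Rmin_left, Rmax_right; lra. }
rewrite Rmin_left, Rmax_right in Hb by lra; eauto.
Qed.

Lemma bx_lt x c : 0 <= x <= 1 -> 0 <= c -> x < xb c -> bx x < c.
Proof.
intros Hx Hc L; destruct (bx_spec x Hx) as [Hb E].
destruct (Rtotal_order (bx x) c) as [|[H|H]]; trivial.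
- rewrite <- H, E in L; lra.
- apply xb_increasing in H; lra.
Qed.

Lemma bx_pos x : 0 < x <= 1 -> 0 < bx x.
Proof.
intros Hx; destruct (bx_spec x ltac:(lra)) as [Hb E].
destruct (Req_dec (bx x) 0) as [E0|]; [|lra].
rewrite E0, xb_0 in E; lra.
Qed.

(** * Closed forms of [h] on the two sides of the break *)

Lemma h_above_break x b : 0 <= b <= 1 -> 0 <= x < xb b -> h x b = exp (b - 1).
Proof.
intros Hb Hx; apply f_unique.
assert (E : exp (b - 1) = / exp (1 - b))
  by (rewrite <- exp_Ropp; f_equal; ring).
pose proof (exp_pos (1 - b)) as P.
assert (EG := G_F b x Hb ltac:(lra)).
assert (Lt : F b x < brk b).
{ destruct (Rlt_dec (F b x) (brk b)); trivial; exfalso.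
  rewrite xb_G in Hx; destruct (Req_dec (F b x) (brk b)) as [Eq|].
  - rewrite Eq in EG; lra.
  - pose proof (G_increasing b (brk b) (F b x) ltac:(lra) ltac:(lra)); lra. }
rewrite E; apply right_slope_inverse with (g := G b); [| | |lra].
- intros s t; apply G_increasing; lra.
- intros t Ht; apply G_F; lra.
(* Since [F b x] lies strictly left of the break, [G b] is linear on a right neighbourhood of it and
   the quotient is constant there. *)
- apply filterlim_ext_loc with (fun _ => exp (1 - b)); [|apply filterlim_const].
  assert (Hp : 0 < brk b - F b x) by lra.
  exists (mkposreal _ Hp); intros s Bs Hs.
  change (Rabs (s - F b x) < brk b - F b x) in Bs.
  rewrite Rabs_right in Bs by lra.
  rewrite <- EG at 1; unfold G.
  destruct (Rle_dec s (brk b)); [|lra].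
  destruct (Rle_dec (F b x) (brk b)); [|lra].
  field; lra.
Qed.

(** Equality [b = beta] is allowed: the preimage is then the break point itself, to the right of
    which the second formula holds. The value [beta = 1] covers [x = 1]. *)
Lemma h_below_break b beta : 0 <= b <= beta -> 0 < beta <= 1 ->
  h (xb beta) b = exp (b - 1) / (1 - exp (- beta)).
Proof.
intros Hb Hbeta; apply f_unique.
set (y := 1 - (1 - beta) * exp b).
assert (Pb := exp_pos b).
assert (Py : brk b <= y) by (unfold brk, y; nra).
assert (Eu : (1 - y) * exp (- b) = 1 - beta).
{ unfold y; replace (1 - (1 - (1 - beta) * exp b)) with ((1 - beta) * exp b) by ring.
  rewrite Rmult_assoc, <- exp_plus, Rplus_opp_r, exp_0; ring. }
assert (EG : G b y = xb beta).
{ rewrite G_second, second_formula, Eu by easy; reflexivity. }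
assert (EF : F b (xb beta) = y) by (rewrite <- EG; apply F_G; lra).
assert (Pd := one_minus_exp_opp_pos beta ltac:(lra)).
assert (P1 := exp_pos (1 - b)).
assert (Px : 0 <= xb beta).
{ rewrite <- xb_0; apply Rlt_le, xb_increasing; lra. }
replace (exp (b - 1) / (1 - exp (- beta)))
  with (/ (exp (1 - b) * (1 - exp (- beta)))).
2:{ replace (b - 1) with (- (1 - b)) by ring.
    rewrite (exp_Ropp (1 - b)); field; lra. }
apply right_slope_inverse with (g := G b).
- intros s t; apply G_increasing; lra.
- intros t Ht; apply G_F; lra.
- rewrite EF.
  assert (D : is_derive
    (fun s => exp ((1 - s) * exp (- b)) - (1 - s) * exp (1 - b)) y
    (exp (1 - b) * (1 - exp (- beta)))).
  (* The derivative is [exp (1 - b) - exp (- b) * exp u] at [u = 1 - beta], from which [exp (1 - b)]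
     factors out. *)
  { auto_derive; trivial.
    replace (1 + - y) with (1 - y) by ring; rewrite Eu.
    replace (1 + - b) with (1 - b) by ring.
    replace (exp (1 - beta)) with (exp 1 * exp (- beta))
      by (rewrite <- exp_plus; f_equal; ring).
    replace (exp (1 - b)) with (exp 1 * exp (- b))
      by (rewrite <- exp_plus; f_equal; ring).
    ring. }
  apply is_derive_right_slope in D.
  refine (filterlim_ext_loc _ _ _ D).
  exists (mkposreal 1 Rlt_0_1); intros s _ Hs.
  rewrite <- EG, !G_second by lra; reflexivity.
- apply Rgt_not_eq, Rmult_lt_0_compat; lra.
Qed.

Lemma h_le_bx x b : 0 < x <= 1 -> 0 <= b <= bx x ->
  h x b = exp (b - 1) / (1 - exp (- bx x)).
Proof.
intros Hx Hb; destruct (bx_spec x ltac:(lra)) as [H1 E].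
rewrite <- E at 1; apply h_below_break; trivial.
split; [apply bx_pos|]; lra.
Qed.

Lemma h_gt_bx x b : 0 <= x <= 1 -> bx x < b <= 1 -> h x b = exp (b - 1).
Proof.
intros Hx Hb; destruct (bx_spec x ltac:(lra)) as [H1 E].
pose proof (xb_increasing (bx x) b ltac:(lra) ltac:(lra)).
apply h_above_break; lra.
Qed.

(** * Auxiliary facts on the exponential and on [bx] near 0 *)

Lemma exp_opp_bx_ratio c z : 0 < z ->
  exp (c - 1) / (1 - exp (- z)) = exp (c - 1) + exp (c - 1) / (exp z - 1).
Proof.
intros Hz; pose proof (exp_minus_1_pos z Hz).
rewrite exp_Ropp; field; pose proof (exp_pos z); lra.
Qed.

Lemma exp_convex s t c : 0 <= c <= 1 ->
  exp (c * s + (1 - c) * t) <= c * exp s + (1 - c) * exp t.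
Proof.
intros Hc; set (m := c * s + (1 - c) * t).
(* Both values lie above the tangent line of [exp] at [m]. *)
assert (T : forall z, exp m * (1 + (z - m)) <= exp z).
{ intros z; replace (exp z) with (exp m * exp (z - m))
    by (rewrite <- exp_plus; f_equal; ring).
  apply Rmult_le_compat_l; [apply Rlt_le, exp_pos|apply exp_ineq1_le]. }
pose proof (T s) as Ts; pose proof (T t) as Tt.
apply (Rmult_le_compat_l c) in Ts; [|lra].
apply (Rmult_le_compat_l (1 - c)) in Tt; [|lra].
apply Rle_trans with (2 := Rplus_le_compat _ _ _ _ Ts Tt).
apply Req_le; unfold m; ring.
Qed.

(** By monotonicity of [xb], [bx x] drops below [c] as soon as [x < xb c], while it stays positive
    for [x > 0]. *)
Lemma filterlim_bx_0 : filterlim bx (at_right 0) (at_right 0).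
Proof.
intros P [e He].
(* The cap at 1 gives [xb c <= 1], so every [x] below [xb c] is in the domain where [bx] inverts
   [xb]. *)
set (c := Rmin e 1).
assert (Hc : 0 < c <= 1 /\ c <= e).
{ pose proof (cond_pos e); unfold c; split; [split|].
  - apply Rmin_pos; lra.
  - apply Rmin_r.
  - apply Rmin_l. }
assert (Hp : 0 < xb c) by (rewrite <- xb_0; apply xb_increasing; lra).
assert (Hp1 : xb c <= 1).
{ destruct (Req_dec c 1) as [->|]; [rewrite xb_1; lra|].
  rewrite <- xb_1; apply Rlt_le, xb_increasing; lra. }
exists (mkposreal _ Hp); intros x Bx Hx.
change (Rabs (x - 0) < xb c) in Bx; rewrite Rabs_right in Bx by lra.
assert (Hb := bx_pos x ltac:(lra)).
apply He; [|easy].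
change (Rabs (bx x - 0) < e); rewrite Rabs_right by lra.
pose proof (bx_lt x c ltac:(lra) ltac:(lra) ltac:(lra)); lra.
Qed.

(** * The case [x = 0]: total mass, and the atom as a weak limit *)

Lemma h_0 b : 0 < b <= 1 -> h 0 b = exp (b - 1).
Proof.
intros Hb; apply h_above_break; [lra|].
pose proof (xb_increasing 0 b ltac:(lra) ltac:(lra)) as H; rewrite xb_0 in H; lra.
Qed.

Lemma is_RInt_h_0 : is_RInt (h 0) 0 1 (1 - exp (- 1)).
Proof.
(* Agreement is asked only on the open interval, which avoids the unspecified value [h 0 0]. *)
apply is_RInt_ext with (fun b => exp (b - 1)).
{ intros b Hb; rewrite Rmin_left, Rmax_right in Hb by lra.
  symmetry; apply h_0; lra. }
replace (1 - exp (- 1)) with (minus (exp (1 - 1)) (exp (0 - 1))).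
2:{ rewrite Rminus_diag, exp_0, Rminus_0_l; reflexivity. }
apply (is_RInt_derive (fun b => exp (b - 1))).
- intros b _; auto_derive; trivial; unfold Rminus; ring.
- intros b _; apply (ex_derive_continuous (fun b => exp (b - 1))).
  auto_derive; trivial.
Qed.

(** The integrand of [phi] against [h 0], written with the closed form so that it is continuous on
    the whole line. *)
Definition weighted (phi : R -> R) (b : R) : R := phi b * exp (b - 1).

Lemma weighted_continuous (phi : R -> R) (Cphi : forall z, continuous phi z) b :
  continuous (weighted phi) b.
Proof.
apply (continuous_mult phi (fun b => exp (b - 1))); [apply Cphi|].
apply (ex_derive_continuous (fun b => exp (b - 1))); auto_derive; trivial.
Qed.

Lemma weighted_integrable (phi : R -> R) (Cphi : forall z, continuous phi z) a b :
  ex_RInt (weighted phi) a b.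
Proof.
apply (ex_RInt_continuous (V := R_CompleteNormedModule)); intros z _.
now apply weighted_continuous.
Qed.

(** Splitting at [bx x] isolates the second summand, the contribution of the excess of [h x] over
    [exp (b - 1)], which produces the atom. *)
Lemma is_RInt_h (phi : R -> R) (Cphi : forall z, continuous phi z) x :
  0 < x < 1 ->
  is_RInt (fun b => phi b * h x b) 0 1
    (RInt (weighted phi) 0 1 + RInt (weighted phi) 0 (bx x) / (exp (bx x) - 1)).
Proof.
intros Hx; destruct (bx_spec x ltac:(lra)) as [Hb _].
assert (Pb := bx_pos x ltac:(lra)).
assert (Pe := exp_minus_1_pos _ Pb).
pose proof (RInt_correct _ _ _ (weighted_integrable phi Cphi 0 (bx x))) as I1.
pose proof (RInt_correct _ _ _ (weighted_integrable phi Cphi (bx x) 1)) as I2.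
pose proof (RInt_Chasles (weighted phi) 0 (bx x) 1
  (weighted_integrable phi Cphi _ _) (weighted_integrable phi Cphi _ _)) as Ch.
change (RInt (weighted phi) 0 (bx x) + RInt (weighted phi) (bx x) 1
  = RInt (weighted phi) 0 1) in Ch.
replace (RInt (weighted phi) 0 1 + RInt (weighted phi) 0 (bx x) / (exp (bx x) - 1))
  with (plus (scal (1 + / (exp (bx x) - 1)) (RInt (weighted phi) 0 (bx x)))
    (RInt (weighted phi) (bx x) 1)).
2:{ rewrite <- Ch; unfold plus, scal; simpl; unfold mult; simpl; field; lra. }
apply (is_RInt_Chasles (V := R_NormedModule) _ 0 (bx x) 1).
- refine (is_RInt_ext _ _ _ _ _ _ (is_RInt_scal _ _ _ (1 + / (exp (bx x) - 1)) _ I1)).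
  intros b Hb'; rewrite Rmin_left, Rmax_right in Hb' by lra.
  rewrite h_le_bx, exp_opp_bx_ratio by lra.
  unfold scal; simpl; unfold mult; simpl; unfold weighted; field; lra.
- refine (is_RInt_ext _ _ _ _ _ _ I2).
  intros b Hb'; rewrite Rmin_left, Rmax_right in Hb' by lra.
  rewrite h_gt_bx by lra; reflexivity.
Qed.

(** A quotient of two right-hand slopes at 0: the integral has derivative [weighted phi 0] there,
    and [exp] has derivative 1. *)
Lemma filterlim_excess_mass (phi : R -> R) (Cphi : forall z, continuous phi z) :
  filterlim (fun z => RInt (weighted phi) 0 z / (exp z - 1)) (at_right 0)
    (locally (exp (- 1) * phi 0)).
Proof.
assert (D : is_derive (fun z => RInt (weighted phi) 0 z) 0 (weighted phi 0)).
{ apply (is_derive_RInt (weighted phi) (fun z => RInt (weighted phi) 0 z) 0 0).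
  - apply filter_forall; intros z.
    apply (RInt_correct (V := R_CompleteNormedModule)), weighted_integrable, Cphi.
  - now apply weighted_continuous. }
assert (E : is_derive exp 0 1).
{ pose proof (is_derive_exp 0) as E; now rewrite exp_0 in E. }
apply is_derive_right_slope in D; apply is_derive_right_slope in E.
replace (exp (- 1) * phi 0) with (weighted phi 0 * / 1).
2:{ unfold weighted; replace (0 - 1) with (- 1) by ring; field. }
assert (I : filterlim Rinv (locally 1) (locally (/ 1))).
{ apply (filterlim_Rbar_inv (Finite 1)); intros H; injection H; lra. }
pose proof (filterlim_comp _ _ _ _ _ _ _ _ E I) as E'.
pose proof (filterlim_comp_2 _ _ _ D E' (filterlim_mult (weighted phi 0) (/ 1))) as M.
refine (filterlim_ext_loc _ _ _ M).
exists (mkposreal 1 Rlt_0_1); intros z _ Hz.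
pose proof (exp_minus_1_pos z Hz).
rewrite RInt_point, exp_0; unfold mult, zero; simpl; field; lra.
Qed.

Lemma h_weak_limit_0 : weakly_converges_with_atom_at_0 h (h 0) (exp (- 1)).
Proof.
intros phi Cphi.
assert (I0 : is_RInt (fun b => phi b * h 0 b) 0 1 (RInt (weighted phi) 0 1)).
{ refine (is_RInt_ext _ _ _ _ _ _
    (RInt_correct _ _ _ (weighted_integrable phi Cphi 0 1))).
  intros b Hb; rewrite Rmin_left, Rmax_right in Hb by lra.
  rewrite h_0 by lra; reflexivity. }
split; [|split].
- intros x Hx; eexists; apply is_RInt_h; eauto.
- now exists (RInt (weighted phi) 0 1).
- rewrite (is_RInt_unique _ _ _ _ I0).
  pose proof (filterlim_comp _ _ _ _ _ _ _ _ filterlim_bx_0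
    (filterlim_excess_mass phi Cphi)) as L.
  pose proof (filterlim_comp_2 _ _ _
    (filterlim_const (F := at_right 0) (RInt (weighted phi) 0 1)) L
    (filterlim_plus (RInt (weighted phi) 0 1) (exp (- 1) * phi 0))) as M.
  refine (filterlim_ext_loc _ _ _ M).
  exists (mkposreal 1 Rlt_0_1); intros x Bx Hx.
  change (Rabs (x - 0) < 1) in Bx; rewrite Rabs_right in Bx by lra.
  symmetry; apply is_RInt_unique, is_RInt_h; [easy|lra].
Qed.

Theorem corollary5 :
  ((forall b, 0 < b <= 1 -> h 0 b = exp (b - 1)) /\
   sub_probability_density (h 0) (1 - exp (- 1)) /\
   weakly_converges_with_atom_at_0 h (h 0) (exp (- 1)))
  /\
  (forall b, 0 <= b <= 1 -> h 1 b = exp b / (exp 1 - 1))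
  /\
  (forall x, 0 < x < 1 ->
    h x 0 = exp (bx x - 1) / (exp (bx x) - 1) /\
    (increasing_on (h x) 0 (bx x) /\ convex_on (h x) 0 (bx x)) /\
    filterlim (h x) (at_left (bx x))
      (locally (exp (bx x - 1) / (1 - exp (- bx x)))) /\
    (forall b, bx x < b <= 1 -> h x b = exp (b - 1))).
Proof.
split; [|split].
- split; [exact h_0|split; [|exact h_weak_limit_0]].
  split; [|split; [exact is_RInt_h_0|]].
  + intros b Hb; rewrite h_0 by easy; apply Rlt_le, exp_pos.
  + pose proof (exp_pos (- 1)); lra.
(* Here [1 = xb 1], so the closed form below the break holds for every [b] in the unit interval. *)
- intros b Hb; pose proof (h_below_break b 1 ltac:(lra) ltac:(lra)) as H.
  rewrite xb_1 in H; rewrite H.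
  pose proof (exp_minus_1_pos 1 ltac:(lra)); pose proof (exp_pos 1).
  unfold Rminus at 1; rewrite exp_plus, exp_Ropp; field; lra.
- intros x Hx.
  assert (Pb := bx_pos x ltac:(lra)).
  assert (Pd := one_minus_exp_opp_pos _ Pb).
  assert (Pe := exp_minus_1_pos _ Pb).
  (* Up to and including [bx x], [h x] is the positive constant [k] times [exp]; monotonicity,
     convexity and the left limit all follow from this. *)
  set (k := / (exp 1 * (1 - exp (- bx x)))).
  assert (Pk : 0 < k).
  { apply Rinv_0_lt_compat, Rmult_lt_0_compat; [apply exp_pos|easy]. }
  assert (Hk : forall b, 0 <= b <= bx x -> h x b = k * exp b).
  { intros b Hb; rewrite h_le_bx by lra; unfold Rminus at 1, k.
    rewrite exp_plus, exp_Ropp; field; pose proof (exp_pos 1); lra. }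
  split; [|split; [split|split]].
  + rewrite h_le_bx by lra; unfold Rminus at 1 3.
    rewrite !exp_plus, !exp_Ropp, exp_0; field.
    pose proof (exp_pos 1); pose proof (exp_pos (bx x)); lra.
  + intros s t Hs Hst Ht; rewrite !Hk by lra.
    apply Rmult_lt_compat_l; [easy|now apply exp_increasing].
  + intros s t c Hs Ht Hc; rewrite !Hk by nra.
    pose proof (exp_convex s t c Hc); nra.
  (* The claimed left limit is the value of [h x] at [bx x], so continuity of [k * exp b]
     suffices. *)
  + rewrite <- h_le_bx, Hk by lra.
    apply filterlim_ext_loc with (fun b => k * exp b).
    * exists (mkposreal _ Pb); intros b Bb Hb.
      change (Rabs (b - bx x) < bx x) in Bb; apply Rabs_def2 in Bb.
      symmetry; apply Hk; lra.
    * apply (filterlim_filter_le_1 (F := locally (bx x)) (G := at_left (bx x))).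
      { apply filter_le_within. }
      apply (ex_derive_continuous (fun b => k * exp b)); auto_derive; trivial.
  + intros b Hb; apply h_gt_bx; lra.
Qed.
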